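(* Let $n\geqslant 0$. For any $i\geqslant 0$ and any consistent set $U\in\mathcal{B}([0,n],i+1)$, the coproduct $\Delta_i^U\colon C_\bullet(\Delta^n)\to C_\bullet(\Delta^n)\otimes C_\bullet(\Delta^n)$ satisfies $$\partial\circ\Delta_i^U-(-1)^i\,\Delta_i^U\circ\partial=(1+(-1)^iT)\,\Delta_{i-1}^{\emptyset}.$$
   Context: Notation. $[0,n]=\{0,\dots,n\}$. $\binom{S}{k}$ is the set of $k$-element subsets of $S$; $|S|$ is the cardinality; $|S|_{<x}=|\{s\in S: s<x\}|$, $|S|_{>x}=|\{s\in S:s>x\}|$. Chains. $C_\bullet(\Delta^n)$ is the chain complex of free $\mathbb{Z}$-modules with basis the non-empty subsets $X\subseteq[0,n]$, $X$ in degree $|X|-1$, with $\partial\{v_0<\dots<v_q\}=\sum_{p=0}^q(-1)^p\{v_0,\dots,\hat v_p,\dots,v_q\}$ for $q\geqslant1$ and $\partial=0$ in degree $0$. On the tensor product, $\partial(x\otimes y)=\partial x\otimes y+(-1)^{\deg x}x\otimes\partial y$ and $T(x\otimes y)=(-1)^{\deg x\deg y}\,y\otimes x$. Consistent sets. $\mathcal{B}([0,n],i+1)$ is the set of consistent subsets $U\subseteq\binom{[0,n]}{i+2}$: for every $M=\{m_0<\dots<m_{i+2}\}\in\binom{[0,n]}{i+3}$, the set of $K\in U$ with $K\subset M$ is a beginning or an ending segment (possibly empty or everything) of $M\setminus m_{i+2}<\dots<M\setminus m_1<M\setminus m_0$. The coproduct $\Delta_i^U$. For $i\geqslant0$, $U\in\mathcal{B}([0,n],i+1)$,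 non-empty $S\subseteq[0,n]$ and $L\in\binom{S}{i+1}$, let $A=A_L^{U,S}$ be the set of $a\in S\setminus L$ such that either $L\cup\{a\}\in U$ and $|L|_{>a}$ is even, or $L\cup\{a\}\notin U$ and $|L|_{>a}$ is odd; let $B=B_L^{U,S}=S\setminus(L\cup A)$. Then $$\Delta_i^U(S)=\sum_{L\in\binom{S}{i+1}}(-1)^{\varepsilon_S(L,A,B)}\,(L\cup A)\otimes(L\cup B),\qquad \varepsilon_S(L,A,B)=\sum_{b\in B}|A|_{<b}+\sum_{l\in L}|L|_{<l}+|S|\,|A|,$$ (so $\Delta_i^U(S)=0$ if $|S|\leqslant i$), extended linearly. $\Delta_{i-1}^{\emptyset}$ is the coproduct associated with $\emptyset\in\mathcal{B}([0,n],i)$ for $i\geqslant1$, and by convention $\Delta_{-1}^{\emptyset}=0$. *)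

(* Defs.v *)
From mathcomp Require Import all_boot all_order all_algebra.
From mathcomp.multinomials Require Export freeg.

Set Implicit Arguments.
Unset Strict Implicit.
Unset Printing Implicit Defensive.

Import GRing.Theory.
Local Open Scope ring_scope.

(* The set [0,n] is 'I_n.+1. *)

Definition cbelow n (S : {set 'I_n.+1}) (x : 'I_n.+1) : nat :=
  #|[set s in S | (s < x)%N]|.

Definition cabove n (S : {set 'I_n.+1}) (x : 'I_n.+1) : nat :=
  #|[set s in S | (s > x)%N]|.

Definition simplex n := {S : {set 'I_n.+1} | S != set0}.

Definition sdim n (X : simplex n) : nat := #|val X|.-1.

(* The underlying ungraded modules of C(Delta^n) and of its tensor square; the
   latter is the free module on pairs of basis elements, with (X, Y) standing
   for the tensor product of the generators X and Y. *)
Definition chain n := {freeg (simplex n) / int}.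
Definition chain2 n := {freeg (simplex n * simplex n) / int}.

(* The junk value for S = set0 is 0; it is never used below. *)
Definition gen n (S : {set 'I_n.+1}) : chain n :=
  if insub S is Some X then << X >> else 0.

Definition tens n (x y : chain n) : chain2 n :=
  fglift (fun X => fglift (fun Y => << (X, Y) >> : chain2 n) y) x.

(* [enum_val p] is the p-th element v_p of X in increasing order. *)
Definition bdry_gen n (X : simplex n) : chain n :=
  if sdim X == 0%N then 0
  else \sum_(p < #|val X|) (-1) ^+ p *: gen (val X :\ enum_val p).

Definition bdry n : chain n -> chain n := fglift (@bdry_gen n).

Definition bdry2 n : chain2 n -> chain2 n :=
  fglift (fun XY : simplex n * simplex n =>
    tens (bdry << XY.1 >>) << XY.2 >>
    + (-1) ^+ sdim XY.1 *: tens << XY.1 >> (bdry << XY.2 >>)).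

Definition swap n : chain2 n -> chain2 n :=
  fglift (fun XY : simplex n * simplex n =>
    (-1) ^+ (sdim XY.1 * sdim XY.2) *: tens << XY.2 >> << XY.1 >>).

(* For M = {m_0 < ... < m_r}: M \ m_r, ..., M \ m_1, M \ m_0, in this order. *)
Definition packet n (M : {set 'I_n.+1}) : seq {set 'I_n.+1} :=
  [seq M :\ m | m <- rev (enum M)].

(* U belongs to B([0,n], k), so its elements have size k + 1. *)
Definition consistent n (k : nat) (U : {set {set 'I_n.+1}}) : Prop :=
  (forall K, K \in U -> #|K| = k.+1) /\
  forall M : {set 'I_n.+1}, #|M| = k.+2 ->
    exists j : nat,
      [set K in U | K \subset M] = [set K in take j (packet M)] \/
      [set K in U | K \subset M] = [set K in drop j (packet M)].

Definition partA n (U : {set {set 'I_n.+1}}) (S L : {set 'I_n.+1}) :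
    {set 'I_n.+1} :=
  [set a in S :\: L |
    ((a |: L) \in U) && ~~ odd (cabove L a)
    || ((a |: L) \notin U) && odd (cabove L a)].

Definition partB n (U : {set {set 'I_n.+1}}) (S L : {set 'I_n.+1}) :
    {set 'I_n.+1} :=
  S :\: (L :|: partA U S L).

Definition epsilon n (S L A B : {set 'I_n.+1}) : nat :=
  (\sum_(b in B) cbelow A b + \sum_(l in L) cbelow L l + #|S| * #|A|)%N.

Definition coproduct_gen n (i : nat) (U : {set {set 'I_n.+1}})
    (X : simplex n) : chain2 n :=
  let S := val X in
  \sum_(L : {set 'I_n.+1} | (L \subset S) && (#|L| == i.+1))
    let A := partA U S L in
    let B := partB U S L in
    (-1) ^+ epsilon S L A B *: tens (gen (L :|: A)) (gen (L :|: B)).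

Definition coproduct n (i : nat) (U : {set {set 'I_n.+1}}) :
    chain n -> chain2 n :=
  fglift (coproduct_gen i U).

(* The coproduct of index i - 1 associated with the empty set, which is 0 by
   convention when i = 0. *)
Definition coproduct_pred n (i : nat) (x : chain n) : chain2 n :=
  if i is j.+1 then coproduct j set0 x else 0.

(* Main.v *)
(* Fix [S] and apply the boundary to the summand of [L]. Removing an element of
   [A] or [B] gives, up to the sign (-1)^i, the summand of [L] in the coproduct
   of a facet of [S], and these terms cancel against the coproduct of the
   boundary. The remaining terms remove some l in [L]; group them by [L' = L - l].
   On the complement [P = S - L'], membership of [L' + x + y] in [U] records which
   pairs are inverted, and consistency of [U] says that the resulting tournament
   on [P] is a linear order. The two terms attached to l are then the partition
   of [P] just before and just after l is passed in this order, where passing l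
   moves it from one part to the other, and they carry opposite signs. The sum
   over l telescopes to the initial partition, which is the summand of [L'] in
   the coproduct of the empty set, minus the final one, in which the two parts
   are exchanged and which is therefore its image under the swap. *)
Require Import Defs.
From HB Require Import structures.
From mathcomp Require Import all_boot all_order all_algebra.
Import GRing.Theory.
Local Open Scope ring_scope.

Set Implicit Arguments.
Unset Strict Implicit.
Unset Printing Implicit Defensive.

(** * Linearity of the maps, and their values on generators *)

HB.instance Definition _ (K : choiceType) (M : lmodType int) (f : K -> M) :=
  GRing.isZmodMorphism.Build {freeg K / int} M (fglift f) (lift_is_additive f).

Lemma fglift_is_scalable (K : choiceType) (M : lmodType int) (f : K -> M) :
  scalable (fglift f).
Proof. by move=> c D; rewrite -[c]intz !scaler_int raddfMz. Qed.

HB.instance Definition _ (K : choiceType) (M : lmodType int) (f : K -> M) :=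
  GRing.isScalable.Build int {freeg K / int} M *:%R (fglift f)
    (@fglift_is_scalable K M f).

HB.instance Definition _ n := GRing.Linear.copy (@bdry n) (fglift (@bdry_gen n)).
HB.instance Definition _ n := GRing.Linear.copy (@bdry2 n) (fglift _).
HB.instance Definition _ n := GRing.Linear.copy (@swap n) (fglift _).
HB.instance Definition _ n i U :=
  GRing.Linear.copy (@coproduct n i U) (fglift (coproduct_gen i U)).

Lemma fgliftE (K : choiceType) (M : lmodType int) (f : K -> M) (k : K) :
  fglift f << k >> = f k.
Proof. by rewrite liftU scale1r. Qed.

Lemma tensEr n (X : simplex n) (y : chain n) :
  tens << X >> y = fglift (fun Y => << (X, Y) >> : chain2 n) y.
Proof. exact: fgliftE. Qed.

Lemma gen_val n (X : simplex n) : gen (val X) = << X >>.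
Proof. by rewrite /gen valK. Qed.

Lemma gen0 n : gen (set0 : {set 'I_n.+1}) = 0.
Proof. by rewrite /gen insubN // eqxx. Qed.

Lemma set_simplexP n (S : {set 'I_n.+1}) : S = set0 \/ exists X : simplex n, S = val X.
Proof.
have [->|S0] := eqVneq S set0; first by left.
by right; exists (exist _ S S0).
Qed.

Lemma tens_suml n (y : chain n) I (r : seq I) (P : pred I) c x :
  tens (\sum_(j <- r | P j) c j *: x j : chain n) y =
  \sum_(j <- r | P j) c j *: tens (x j) y.
Proof. by rewrite /tens linear_sum; apply: eq_bigr => j _; rewrite linearZ. Qed.

Lemma tens0l n (y : chain n) : tens 0 y = 0.
Proof. exact: linear0. Qed.

Lemma tens_genr_sum n (S : {set 'I_n.+1}) I (r : seq I) (P : pred I) c y :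
  tens (gen S) (\sum_(j <- r | P j) c j *: y j : chain n) =
  \sum_(j <- r | P j) c j *: tens (gen S) (y j).
Proof.
have [->|[X ->]] := set_simplexP S.
  by rewrite gen0 tens0l big1 // => j _; rewrite tens0l scaler0.
rewrite gen_val tensEr linear_sum; apply: eq_bigr => j _.
by rewrite linearZ tensEr.
Qed.

Lemma tens0r n (S : {set 'I_n.+1}) : tens (gen S) 0 = 0.
Proof.
by have := tens_genr_sum S [::] xpredT (fun=> 0) (fun i : nat => 0); rewrite !big_nil.
Qed.

Lemma sorted_enum_ord n (S : {set 'I_n.+1}) : sorted <%O (enum S).
Proof.
rewrite {1}/enum_mem; apply: sorted_filter; first exact: Order.POrderTheory.lt_trans.
have := iota_ltn_sorted 0 n.+1.
by rewrite -val_enum_ord sorted_map enumT.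
Qed.

(** Turns the position in the boundary sign into a count, so that boundaries become sums over
    elements. *)
Lemma cbelow_enum_val n (S : {set 'I_n.+1}) (p : 'I_#|S|) : cbelow S (enum_val p) = p.
Proof.
have pS : (p < size (enum S))%N by rewrite -cardE.
rewrite -[RHS](Order.POrderTheory.count_lt_nth (enum_default p) (sorted_enum_ord S) pS).
rewrite /cbelow cardsE cardE -size_filter [enum S]/enum_mem -filter_predI; congr size.
by apply: eq_filter => x; rewrite !inE andbC.
Qed.

(** Since [gen set0 = 0], one formula also covers degree 0: the only face of a point is empty and
    contributes nothing. *)
Lemma bdry_genE n (S : {set 'I_n.+1}) :
  bdry (gen S) = \sum_(x in S) (-1) ^+ cbelow S x *: gen (S :\ x).
Proof.
have [->|[X ->]] := set_simplexP S; first by rewrite gen0 big_set0 linear0.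
rewrite gen_val /bdry fgliftE /bdry_gen /sdim [RHS]big_enum_val.
case: eqP => [X1|_]; last by apply: eq_bigr => p _; rewrite cbelow_enum_val.
rewrite big1 // => p _.
suff -> : val X :\ enum_val p = set0 by rewrite gen0 scaler0.
apply/eqP; rewrite -cards_eq0 -X1.
by rewrite (cardsD1 (enum_val p) (val X)) enum_valP.
Qed.

Lemma bdry2_tens n (S T : {set 'I_n.+1}) :
  bdry2 (tens (gen S) (gen T)) =
  \sum_(x in S) (-1) ^+ cbelow S x *: tens (gen (S :\ x)) (gen T)
  + (-1) ^+ #|S|.-1 *: \sum_(y in T) (-1) ^+ cbelow T y *: tens (gen S) (gen (T :\ y)).
Proof.
have [->|[X ->]] := set_simplexP S.
  rewrite gen0 tens0l big_set0 linear0 add0r big1 ?scaler0 // => y _.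
  by rewrite tens0l scaler0.
have [->|[Y ->]] := set_simplexP T.
  rewrite gen0 tens0r linear0 big_set0 scaler0 addr0 big1 // => x _.
  by rewrite tens0r scaler0.
rewrite !gen_val tensEr fgliftE /bdry2 fgliftE -!gen_val !bdry_genE /= /sdim.
rewrite tens_genr_sum linear_sum; congr (_ + _).
exact: tens_suml.
Qed.

Lemma swap_tens n (S T : {set 'I_n.+1}) :
  swap (tens (gen S) (gen T)) =
  (-1) ^+ (#|S|.-1 * #|T|.-1) *: tens (gen T) (gen S).
Proof.
have [->|[X ->]] := set_simplexP S.
  by rewrite gen0 tens0r tens0l linear0 scaler0.
have [->|[Y ->]] := set_simplexP T.
  by rewrite gen0 tens0r tens0l linear0 scaler0.
by rewrite !gen_val tensEr fgliftE /swap fgliftE.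
Qed.

Lemma coproduct_genE n i (U : {set {set 'I_n.+1}}) (S : {set 'I_n.+1}) :
  coproduct i U (gen S) =
  \sum_(L : {set 'I_n.+1} | (L \subset S) && (#|L| == i.+1))
    (-1) ^+ epsilon S L (partA U S L) (partB U S L)
      *: tens (gen (L :|: partA U S L)) (gen (L :|: partB U S L)).
Proof.
have [->|[X ->]] := set_simplexP S; last by rewrite gen_val /coproduct fgliftE.
rewrite gen0 linear0 big_pred0 // => L.
by apply/negP => /andP[]; rewrite subset0 => /eqP->; rewrite cards0.
Qed.

Lemma chain_ind n (P : chain n -> Prop) :
  P 0 -> (forall x y, P x -> P y -> P (x + y)) -> (forall c x, P x -> P (c *: x)) ->
  (forall X : simplex n, P (gen (val X))) -> forall x, P x.
Proof.
move=> P0 PD PZ PX x; rewrite -[x]freeg_sumE.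
apply: big_ind => // X _.
rewrite -[coeff X x]mulr1.
have -> (c : int): << c * 1 *g X >> = c *: << X >> :> chain n.
  by apply/eqP/freeg_eqP=> z; rewrite coeffZ !coeffU mulrA.
by apply: PZ; rewrite -gen_val.
Qed.

(** * Disjoint unions, and counts of elements below or above a point *)

Lemma big_setU_disjoint {R : Type} {idx : R} {op : Monoid.com_law idx} {T : finType}
  (A B : {set T}) (F : T -> R) :
  [disjoint A & B] ->
  \big[op/idx]_(x in A :|: B) F x =
  op (\big[op/idx]_(x in A) F x) (\big[op/idx]_(x in B) F x).
Proof. by move=> dAB; rewrite -bigU //=; apply: eq_bigl => x; rewrite !inE. Qed.

Lemma cardsU_disjoint {T : finType} (A B : {set T}) :
  [disjoint A & B] -> #|A :|: B| = (#|A| + #|B|)%N.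
Proof. by move=> dAB; apply/eqP; rewrite leq_card_setU. Qed.

Lemma setU_setD1 (T : finType) (A B : {set T}) x : x \notin A -> (A :|: B) :\ x = A :|: B :\ x.
Proof.
move=> xA; apply/setP => y; rewrite !inE; case: (eqVneq y x) => [->|] //=.
by rewrite (negPf xA).
Qed.

Lemma setD1_notin (T : finType) (A : {set T}) x : x \notin A -> A :\ x = A.
Proof. by move=> xA; rewrite -[in LHS](setU0 A) setU_setD1 // set0D setU0. Qed.

Section Counting.
Context {n : nat}.
Implicit Types (S L A B : {set 'I_n.+1}) (x l a b : 'I_n.+1).

(** Both sums in [epsilon] have this form, the second with both arguments equal to [L]. *)
Definition inversions A B : nat := (\sum_(b in B) cbelow A b)%N.

Lemma cbelowE A x : cbelow A x = (\sum_(a in A) (a < x)%N)%N.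
Proof.
rewrite /cbelow -sum1_card big_mkcond [RHS]big_mkcond; apply: eq_bigr => a _.
by rewrite !inE; case: (a \in A).
Qed.

Lemma caboveE A x : cabove A x = (\sum_(a in A) (x < a)%N)%N.
Proof.
rewrite /cabove -sum1_card big_mkcond [RHS]big_mkcond; apply: eq_bigr => a _.
by rewrite !inE; case: (a \in A).
Qed.

Lemma cbelowU A B x : [disjoint A & B] ->
  cbelow (A :|: B) x = (cbelow A x + cbelow B x)%N.
Proof. by move=> dAB; rewrite !cbelowE big_setU_disjoint. Qed.

Lemma cbelowU1 A a x : a \notin A -> cbelow (a |: A) x = ((a < x) + cbelow A x)%N.
Proof. by move=> aA; rewrite !cbelowE big_setU1. Qed.

Lemma caboveU1 A a x : a \notin A -> cabove (a |: A) x = ((x < a) + cabove A x)%N.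
Proof. by move=> aA; rewrite !caboveE big_setU1. Qed.

Lemma cbelowDcabove A x : x \notin A -> (cbelow A x + cabove A x)%N = #|A|.
Proof.
move=> xA; rewrite cbelowE caboveE -big_split -sum1_card; apply: eq_bigr => a aA /=.
have : a != x by apply: contraNneq xA => <-.
by rewrite neq_ltn => /orP[] ax; rewrite ax ltnNge (ltnW ax).
Qed.

Lemma inversionsU1l A B a : a \notin A ->
  inversions (a |: A) B = (inversions A B + cabove B a)%N.
Proof.
move=> aA; rewrite /inversions caboveE -big_split.
by apply: eq_bigr => b _; rewrite cbelowU1 // addnC.
Qed.

Lemma inversionsU1r A B b : b \notin B ->
  inversions A (b |: B) = (inversions A B + cbelow A b)%N.
Proof. by move=> bB; rewrite /inversions big_setU1 //= addnC. Qed.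

(** Each pair in [A] times [B] is counted by exactly one of the two terms. *)
Lemma inversions_swap A B : [disjoint A & B] ->
  (inversions A B + inversions B A)%N = (#|A| * #|B|)%N.
Proof.
move=> dAB; rewrite /inversions.
have -> : (\sum_(a in A) cbelow B a = \sum_(b in B) cabove A b)%N.
  rewrite (eq_bigr (fun a : 'I__ => \sum_(b in B) (b < a)%N)%N); last first.
    by move=> a _; rewrite cbelowE.
  by rewrite exchange_big; apply: eq_bigr => b _; rewrite caboveE.
rewrite -big_split mulnC -sum_nat_const; apply: eq_bigr => b bB /=.
by rewrite cbelowDcabove // (disjointFl dAB).
Qed.

(** The sign computations are made for an arbitrary such partition, independently of [U]. *)
Definition part3 S L A B : Prop :=
  [/\ S = L :|: A :|: B, [disjoint L & A], [disjoint L & B] & [disjoint A & B]].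

Lemma part3_disjoint S L A B : part3 S L A B -> [disjoint L :|: A & B].
Proof. by case=> _ _ LB AB; rewrite -setI_eq0 setIUl setU_eq0 !setI_eq0 LB. Qed.

Lemma part3_card S L A B : part3 S L A B -> #|S| = (#|L| + #|A| + #|B|)%N.
Proof.
move=> p3; have d := part3_disjoint p3; case: p3 => -> LA _ _.
by rewrite !cardsU_disjoint.
Qed.

Lemma part3_cbelow S L A B x : part3 S L A B ->
  cbelow S x = (cbelow L x + cbelow A x + cbelow B x)%N.
Proof.
move=> p3; have d := part3_disjoint p3; case: p3 => -> LA _ _.
by rewrite !cbelowU.
Qed.

End Counting.

(** * Signs, as parities of exponents *)

Ltac parity := rewrite ?(oddD, oddM, oddS); repeat (case: (odd _) => //=).

Section Signs.
Context {n : nat}.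
Implicit Types (S L A B : {set 'I_n.+1}) (x l a b : 'I_n.+1).

Lemma epsilonE S L A B :
  epsilon S L A B = (inversions A B + inversions L L + #|S| * #|A|)%N.
Proof. by []. Qed.

(** Deleting [a] lowers [inversions A B] by [cabove B a] and [#|S| * #|A|] by [#|S| + #|A| - 1]. As
    [#|S| = i + 1 + #|A| + #|B|], the total has the parity of [i + cbelow B a], and [cbelow B a] is
    what [cbelow S a] adds to [cbelow (L :|: A) a]. *)
Lemma epsilonD1l i S L A B a : part3 S L A B -> #|L| = i.+1 -> a \in A ->
  odd (epsilon S L A B + cbelow (L :|: A) a) =
  odd (i + cbelow S a + epsilon (S :\ a) L (A :\ a) B).
Proof.
move=> p3 Li aA; have [SE LA LB AB] := p3.
have SA : a \in S by rewrite SE !inE aA orbT.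
have aB : a \notin B by rewrite (disjointFr AB).
have := part3_card p3; rewrite (cardsD1 a S) SA Li /= => cS.
have cA : #|A| = (#|A :\ a|).+1 by rewrite (cardsD1 a) aA.
have cSa : #|S :\ a| = (i + #|A| + #|B|)%N.
  by apply/eqP; rewrite -eqSS -addSn -[X in X == _]add1n cS.
rewrite !epsilonE (part3_cbelow a p3) (cbelowU _ LA).
rewrite -{1}(setD1K aA) inversionsU1l ?setD11 // (cardsD1 a S) SA cSa.
rewrite -(cbelowDcabove aB) cA.
by parity.
Qed.

(** The loss of [#|A|] in [#|S| * #|A|] cancels against the degree [i + #|A|] of the left factor,
    leaving [i]. *)
Lemma epsilonD1r i S L A B b : part3 S L A B -> #|L| = i.+1 -> b \in B ->
  odd (epsilon S L A B + (#|L :|: A|.-1 + cbelow (L :|: B) b)) =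
  odd (i + cbelow S b + epsilon (S :\ b) L A (B :\ b)).
Proof.
move=> p3 Li bB; have [SE LA LB AB] := p3.
have SB : b \in S by rewrite SE !inE bB !orbT.
rewrite !epsilonE (part3_cbelow b p3) (cbelowU _ LB) cardsU_disjoint // Li /=.
rewrite -{1}(setD1K bB) inversionsU1r ?setD11 // (cardsD1 b S) SB.
by parity.
Qed.

(** Deleted from the left factor, [l] survives only in the right one: it moves from [L] to [B]. *)
Lemma epsilon_shiftl S L A B l : part3 S (l |: L) A B -> l \notin L ->
  odd (epsilon S (l |: L) A B + cbelow ((l |: L) :|: A) l) =
  odd (cabove L l + epsilon S L A (l |: B)).
Proof.
move=> p3 lL; have [SE LA LB AB] := p3.
have lA : l \notin A by rewrite (disjointFr LA) // !inE eqxx.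
have lB : l \notin B by rewrite (disjointFr LB) // !inE eqxx.
rewrite !epsilonE (cbelowU _ LA) cbelowU1 // ltnn.
rewrite !inversionsU1r // !inversionsU1l //.
rewrite ?cbelowU1 // ltnn.
by parity.
Qed.

(** Here [l] moves to [A]. The negation is the parity of [#|S| + #|L| + #|A| + #|B|], odd because
    [l] is the one further element of [S]. *)
Lemma epsilon_shiftr S L A B l : part3 S (l |: L) A B -> l \notin L ->
  odd (epsilon S (l |: L) A B + (#|(l |: L) :|: A|.-1 + cbelow ((l |: L) :|: B) l)) =
  ~~ odd (cabove L l + epsilon S L (l |: A) B).
Proof.
move=> p3 lL; have [SE LA LB AB] := p3.
have lA : l \notin A by rewrite (disjointFr LA) // !inE eqxx.
have lB : l \notin B by rewrite (disjointFr LB) // !inE eqxx.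
rewrite !epsilonE (cbelowU _ LB) cbelowU1 // ltnn.
rewrite !inversionsU1r // !inversionsU1l // cardsU_disjoint // !cardsU1 lL lA (part3_card p3).
rewrite cardsU1 lL -(cbelowDcabove lB) -(cbelowDcabove lL) ?cbelowU1 // ltnn /=.
by parity.
Qed.

(** The exchange contributes [#|A| * #|B|] from the inversions and [#|S| * (#|A| + #|B|)]; modulo 2
    this is [i] plus the product of the degrees, the exponent in [swap]. *)
Lemma epsilon_swap i S L A B : part3 S L A B -> #|L| = i.+1 ->
  odd (epsilon S L B A) =
  odd (i + #|L :|: A|.-1 * #|L :|: B|.-1 + epsilon S L A B).
Proof.
move=> p3 Li; have [SE LA LB AB] := p3.
rewrite !epsilonE !cardsU_disjoint // Li (part3_card p3) Li.
have := congr1 odd (inversions_swap AB).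
by parity.
Qed.

End Signs.

(** * Telescoping sums along a linear order *)

Section Telescoping.
Variables (T : finType) (V : zmodType) (r : rel T) (F : {set T} -> V).

(** Take [m] with the most predecessors: if [m] preceded [x], then by transitivity [x] would have
    all of these and [m] as well. *)
Lemma total_max (P : {set T}) :
  P != set0 -> {in P, irreflexive r} ->
  {in P &, forall x y, x != y -> r y x = ~~ r x y} -> {in P & &, transitive r} ->
  exists2 m, m \in P & {in P, forall x, r x m = (x != m)}.
Proof.
move=> /set0Pn[x0 Px0] rI rT rTr.
case: (arg_maxnP (fun m => #|[set x in P | r x m]|) Px0) => m Pm0 maxm.
have Pm : m \in P := Pm0.
exists m => // x Px; have [->|xm] := eqVneq x m; first exact: rI.
rewrite rT // 1?eq_sym //; apply/negP => mx.
have := maxm x Px; rewrite /= leqNgt => /negP[].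
apply/proper_card/properP; split; last first.
  by exists m; rewrite !inE Pm ?mx // rI.
apply/subsetP => y; rewrite !inE => /andP[Py ym]; rewrite Py.
exact: rTr ym mx.
Qed.

(** Induction on [P] by removing its maximum [m]: the term of [m] is [F (P :\ m) - F P], and [m]
    precedes no other element. *)
Lemma sum_telescope_total (P : {set T}) :
  {in P, irreflexive r} ->
  {in P &, forall x y, x != y -> r y x = ~~ r x y} -> {in P & &, transitive r} ->
  \sum_(l in P) (F [set x in P | r x l] - F (l |: [set x in P | r x l])) =
  F set0 - F P.
Proof.
have [k] := ubnP #|P|; elim: k P => // k IHk P Pk rI rT rTr.
have [->|P0] := eqVneq P set0; first by rewrite big_set0 subrr.
have [m Pm mP] := total_max P0 rI rT rTr.
have sQ x : x \in P :\ m -> x \in P by rewrite !inE => /andP[].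
have -> : F set0 - F P = F (P :\ m) - F P + (F set0 - F (P :\ m)).
  by rewrite [RHS]addrC addrA subrK.
have Dm : [set x in P | r x m] = P :\ m.
  by apply/setP => x; rewrite !inE andbC; case: (boolP (x \in P)) => [/mP->|]; rewrite ?andbF.
rewrite (big_setD1 m) //= Dm setD1K //; congr (_ + _).
rewrite -IHk; first last.
- by move=> y x z /sQ Py /sQ Px /sQ Pz; apply: rTr.
- by move=> x y /sQ Px /sQ Py; apply: rT.
- by move=> x /sQ; apply: rI.
- by move: Pk; rewrite (cardsD1 m) Pm.
apply: eq_bigr => l lQ.
suff -> : [set x in P | r x l] = [set x in P :\ m | r x l] by [].
apply/setP => x; rewrite !inE; have [->|//] := eqVneq x m.
have Pl := sQ _ lQ.
move: lQ; rewrite !inE => /andP[lm _].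
by rewrite rT // mP // lm andbF.
Qed.

End Telescoping.

(** * From consistency to a linear order *)

Lemma mem_map_setD1 (T : finType) (M : {set T}) (s : seq T) x :
  x \in M -> {subset s <= M} -> (M :\ x \in [seq M :\ m | m <- s]) = (x \in s).
Proof.
move=> xM sM; apply/mapP/idP => [[y ys]|xs]; last by exists x.
move=> /setP/(_ x); rewrite !inE eqxx xM andbT /=.
by case: eqVneq => [->|].
Qed.

Lemma take_drop_rev_enum n (M : {set 'I_n.+1}) j x y :
  x \in take j (rev (enum M)) -> y \in drop j (rev (enum M)) -> (y < x)%N.
Proof.
have : pairwise (fun x y : 'I_n.+1 => (y < x)%O) (rev (enum M)).
  rewrite -sorted_pairwise; last by move=> ? ? ? /[swap]; apply: Order.POrderTheory.lt_trans.
  by rewrite rev_sorted sorted_enum_ord.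
rewrite -{1}(cat_take_drop j (rev (enum M))) pairwise_cat => /andP[/allrelP H _].
by move=> /H/[apply].
Qed.

(** The packet deletes the elements of [M] in decreasing order, so a beginning segment gives an
    upward closed set of deleted elements and an ending segment a downward closed one. *)
Lemma consistent_monotone n k (U : {set {set 'I_n.+1}}) (M : {set 'I_n.+1}) :
  consistent k U -> #|M| = k.+2 ->
  {in M &, forall x y : 'I_n.+1, (x < y)%N -> M :\ x \in U -> M :\ y \in U} \/
  {in M &, forall x y : 'I_n.+1, (x < y)%N -> M :\ y \in U -> M :\ x \in U}.
Proof.
case=> _ cU /cU[j].
have UE x :
    M :\ x \in U = (M :\ x \in [set K in U | K \subset M]).
  by rewrite inE subD1set andbT.
have E x : x \in M -> x \in take j (rev (enum M)) ++ drop j (rev (enum M)).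
  by rewrite cat_take_drop mem_rev mem_enum.
have sub_take : {subset take j (rev (enum M)) <= M}.
  by move=> z /mem_take; rewrite mem_rev mem_enum.
have sub_drop : {subset drop j (rev (enum M)) <= M}.
  by move=> z /mem_drop; rewrite mem_rev mem_enum.
case=> ME; [left|right] => x y Mx My xy; rewrite !UE !ME !inE -?map_take -?map_drop
  !mem_map_setD1 // => Hin; have := E _ Mx; have := E _ My; rewrite !mem_cat.
- move=> /orP[//|yd] _.
  by have := take_drop_rev_enum Hin yd; rewrite ltnNge (ltnW xy).
- move=> _ /orP[xt|//].
  by have := take_drop_rev_enum xt Hin; rewrite ltnNge (ltnW xy).
Qed.

(* The linear order on the complement of [L] whose inversions are the pairs
   [x, y] with [L + x + y] in [U]. *)
Definition link_rel n (U : {set {set 'I_n.+1}}) (L : {set 'I_n.+1}) : rel 'I_n.+1 :=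
  fun x y => (x != y) && ((x < y)%N (+) ((x |: (y |: L)) \in U)).

Section LinkOrder.
Variables (n i : nat) (U : {set {set 'I_n.+1}}) (L : {set 'I_n.+1}).
Hypotheses (hU : consistent i.+1 U) (Li : #|L| = i).
Local Notation r := (link_rel U L).

Lemma link_rel_irr : irreflexive r.
Proof. by move=> x; rewrite /link_rel eqxx. Qed.

Lemma link_rel_total x y : x != y -> r y x = ~~ r x y.
Proof.
move=> xy; rewrite /link_rel eq_sym xy setUCA /=.
by case: ltngtP xy => //= [_|/val_inj->]; rewrite ?eqxx ?negbK.
Qed.

(** A 3-cycle determines which of [M :\ x], [M :\ y], [M :\ z] lie in [U]: the facet missing the
    middle element behaves oppositely to the other two, which monotonicity forbids. *)
Lemma link_rel_acyclic x y z :
  x \notin L -> y \notin L -> z \notin L -> r x y -> r y z -> ~~ r z x.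
Proof.
move=> xL yL zL /andP[xy Uxy] /andP[yz Uyz]; apply/negP => /andP[zx Uzx].
pose M := x |: (y |: (z |: L)).
have cM : #|M| = i.+3.
  by rewrite !cardsU1 !inE (negPf xy) (negPf yz) [x == z]eq_sym (negPf zx) xL yL zL Li.
have [Mx My Mz] : [/\ x \in M, y \in M & z \in M] by rewrite !inE !eqxx !orbT.
have EMx : M :\ x = y |: (z |: L).
  by rewrite setU1K // !inE (negPf xy) eq_sym (negPf zx) xL.
have EMy : M :\ y = z |: (x |: L).
  by rewrite [RHS]setUCA /M setUCA setU1K // !inE eq_sym (negPf xy) (negPf yz) yL.
have EMz : M :\ z = x |: (y |: L).
  rewrite /M (setUCA [set y]) (setUCA [set x]) setU1K // !inE (negPf zx).
  by rewrite eq_sym (negPf yz) zL.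
move: Uxy Uyz Uzx; rewrite -EMx -EMy -EMz.
have ltN (a b : 'I_n.+1) : a != b -> (b < a)%N = ~~ (a < b)%N.
  by move=> ab; rewrite ltn_neqAle -leqNgt eq_sym val_eqE ab.
(* The order on the three points excludes these two cyclic patterns; a finite Boolean check
   remains. *)
have lt3 : ~~ [&& (x < y), (y < z) & (z < x)]%N.
  by apply/and3P => -[/ltn_trans/[apply] /ltn_trans/[apply]]; rewrite ltnn.
have gt3 : ~~ [&& (y < x), (z < y) & (x < z)]%N.
  by apply/and3P => -[yx zy] /ltn_trans/(_ zy)/ltn_trans/(_ yx); rewrite ltnn.
rewrite (ltN _ _ xy) (ltN _ _ yz) (ltN _ _ zx) in gt3.
have mono : (forall a b : 'I_n.+1, a \in M -> b \in M ->
      [==> (a < b)%N, M :\ a \in U => M :\ b \in U]) \/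
    (forall a b : 'I_n.+1, a \in M -> b \in M ->
      [==> (a < b)%N, M :\ b \in U => M :\ a \in U]).
  case: (consistent_monotone hU cM) => mono; [left|right] => a b Ma Mb;
    by apply/implyP => ab; apply/implyP; apply: mono.
case: mono => mono; move: (mono _ _ Mx My) (mono _ _ My Mx) (mono _ _ My Mz)
  (mono _ _ Mz My) (mono _ _ Mz Mx) (mono _ _ Mx Mz) lt3 gt3;
  rewrite (ltN _ _ xy) (ltN _ _ yz) (ltN _ _ zx);
  case: (M :\ x \in U); case: (M :\ y \in U); case: (M :\ z \in U);
  by case: (x < y)%N; case: (y < z)%N; case: (z < x)%N.
Qed.

Lemma link_rel_trans x y z :
  x \notin L -> y \notin L -> z \notin L -> r x y -> r y z -> r x z.
Proof.
move=> xL yL zL xy yz.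
have xz : z != x.
  apply: contraTneq yz => ->; rewrite link_rel_total ?xy //.
  by case/andP: xy.
by rewrite link_rel_total // (link_rel_acyclic xL yL zL).
Qed.

End LinkOrder.

(** * Reindexing of sums and comparison of signs *)

Lemma sum_flags (T : finType) (V : nmodType) (S : {set T}) i (H : {set T} -> T -> V) :
  \sum_(L : {set T} | (L \subset S) && (#|L| == i.+1)) \sum_(l in L) H (L :\ l) l =
  \sum_(L : {set T} | (L \subset S) && (#|L| == i)) \sum_(l in S :\: L) H L l.
Proof.
rewrite !pair_big_dep /=.
(* Pairs with [l] in the set correspond to pairs with [l] outside it by deleting or adding [l]. *)
rewrite (reindex_onto (fun p => (p.2 |: p.1, p.2)) (fun p => (p.1 :\ p.2, p.2))) /=.
  apply: congr_big => // [[L l]|[L l]] /=; last by case/andP => _ /eqP[->].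
  rewrite xpair_eqE eqxx andbT !inE eqxx andbT subUset sub1set.
  have [lL|lL] := boolP (l \in L).
    rewrite andbF; apply/negbTE/negP => /andP[_ /eqP/setP/(_ l)].
    by rewrite !inE eqxx lL.
  rewrite setU1K // eqxx andbT cardsU1 lL add1n eqSS.
  by case: (l \in S); rewrite ?andbF ?andbT.
by move=> [L l] /= /andP[_ lL]; rewrite setD1K.
Qed.

Lemma eq_signr (R : pzRingType) (V : lmodType R) (a b : nat) (v : V) :
  odd a = odd b -> (-1) ^+ a *: v = (-1) ^+ b *: v.
Proof. by move=> ab; rewrite -signr_odd ab signr_odd. Qed.

Lemma eq_signrN (R : pzRingType) (V : lmodType R) (a b : nat) (v : V) :
  odd a = ~~ odd b -> (-1) ^+ a *: v = - ((-1) ^+ b *: v).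
Proof. by move=> ab; rewrite -signr_odd ab signrN scaleNr signr_odd. Qed.

(** * The terms of the boundary of the coproduct *)

Section Assembly.
Context {n : nat}.
Implicit Types (S L A B : {set 'I_n.+1}) (U : {set {set 'I_n.+1}}).

(** [A] and [B] are left arbitrary to cover the intermediate partitions of the telescoping sum and
    their exchanges. *)
Definition summand S L A B : chain2 n :=
  (-1) ^+ epsilon S L A B *: tens (gen (L :|: A)) (gen (L :|: B)).

Lemma part3_parts U S L : L \subset S -> part3 S L (partA U S L) (partB U S L).
Proof.
move=> LS; split.
- apply/setP => x; rewrite !inE; have := subsetP LS x.
  case: (x \in L) => /= [->//|_]; case: (x \in S) => //=.
  by rewrite ?orbN // ?andbT orbN.
- by rewrite -setI_eq0; apply/eqP/setP => x; rewrite !inE; case: (x \in L).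
- by rewrite -setI_eq0; apply/eqP/setP => x; rewrite !inE; case: (x \in L).
- rewrite -setI_eq0; apply/eqP/setP => x; rewrite !inE /=.
  by case: (x \in S); case: (x \in L); rewrite //= ?andbT ?andbN.
Qed.

(** An element of [A] or [B] occurs in one tensor factor, so deleting it passes to a facet of [S].
    An element of [L] occurs in both, so deleting one copy keeps [S] and moves [l] to [B] or [A]. *)
Lemma bdry2_summand i S L A B : part3 S L A B -> #|L| = i.+1 ->
  bdry2 (summand S L A B) =
  (-1) ^+ i *: (\sum_(a in A) (-1) ^+ cbelow S a *: summand (S :\ a) L (A :\ a) B
                + \sum_(b in B) (-1) ^+ cbelow S b *: summand (S :\ b) L A (B :\ b))
  + \sum_(l in L) (-1) ^+ cabove (L :\ l) l *:
      (summand S (L :\ l) A (l |: B) - summand S (L :\ l) (l |: A) B).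
Proof.
move=> p3 Li; have [SE LA LB AB] := p3.
have LAB := part3_disjoint p3.
rewrite [in LHS]/summand linearZ /= bdry2_tens !big_setU_disjoint //= !scalerDr.
rewrite addrACA addrC !scalerA !scaler_sumr -!big_split /=; congr (_ + _ + _).
- apply: eq_bigr => a aA; have aL : a \notin L by rewrite (disjointFl LA).
  rewrite /summand !scalerA -!exprD setU_setD1 //.
  by apply: eq_signr; rewrite (epsilonD1l p3 Li aA).
- apply: eq_bigr => b bB; have bL : b \notin L by rewrite (disjointFl LB).
  rewrite /summand !scalerA -!exprD setU_setD1 // -addnA.
  by apply: eq_signr; rewrite (epsilonD1r p3 Li bB).
apply: eq_bigr => l lL.
have lA : l \notin A by rewrite (disjointFr LA).
have lB : l \notin B by rewrite (disjointFr LB).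
have lLl : l \notin L :\ l by rewrite setD11.
have p3l : part3 S (l |: L :\ l) A B by rewrite setD1K.
have lU (C : {set 'I_n.+1}) : l \notin C -> (L :|: C) :\ l = L :\ l :|: C.
  by move=> lC; rewrite setUC setU_setD1 // setUC.
have sU (C : {set 'I_n.+1}) : L :\ l :|: (l |: C) = L :|: C by rewrite setUCA setUA setD1K.
have eL := epsilon_shiftl p3l lLl; have eR := epsilon_shiftr p3l lLl.
rewrite !setD1K // in eL eR.
rewrite /summand !scalerBr !scalerA -!exprD !lU // !sU -addnA.
by rewrite (eq_signr _ eL) (eq_signrN _ eR).
Qed.

Lemma partA_setD1 U S L s : partA U (S :\ s) L = partA U S L :\ s.
Proof. by apply/setP => x; rewrite !inE; case: (x == s); rewrite /= ?andbF. Qed.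

Lemma partB_setD1 U S L s : partB U (S :\ s) L = partB U S L :\ s.
Proof.
apply/setP => x; rewrite /partB partA_setD1 !inE.
by case: (x == s); rewrite /= ?andbF.
Qed.

(** Whether [a] lies in [A] or [B] depends only on [U], [L] and [a], so on a facet the parts merely
    lose [s], and for fixed [L] the deleted [s] ranges over both parts. *)
Lemma coproduct_bdry i U S :
  coproduct i U (bdry (gen S)) =
  \sum_(L : {set 'I_n.+1} | (L \subset S) && (#|L| == i.+1))
    (\sum_(a in partA U S L) (-1) ^+ cbelow S a *:
       summand (S :\ a) L (partA U S L :\ a) (partB U S L)
     + \sum_(b in partB U S L) (-1) ^+ cbelow S b *:
       summand (S :\ b) L (partA U S L) (partB U S L :\ b)).
Proof.
rewrite bdry_genE linear_sum /=.
under eq_bigr => s _ do rewrite linearZ /= coproduct_genE scaler_sumr.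
rewrite (exchange_big_dep
  (fun L : {set 'I_n.+1} => (L \subset S) && (#|L| == i.+1))) /=; last first.
  by move=> s L _ /andP[/subset_trans-> //]; rewrite ?subsetDl.
apply: eq_bigr => L /andP[LS cL]; have p3 := part3_parts U LS.
have [SE LA LB AB] := p3.
pose A := partA U S L; pose B := partB U S L.
(* As [s] lies in only one of the parts, deleting it from both gives a common form for the two
   sums. *)
pose G s := (-1) ^+ cbelow S s *: summand (S :\ s) L (A :\ s) (B :\ s).
rewrite [X in _ = X + _](eq_bigr G) => [|a aA]; last first.
  by rewrite /G [B :\ a]setD1_notin // /B (disjointFr AB).
rewrite [X in _ = _ + X](eq_bigr G) => [|b bB]; last first.
  by rewrite /G [A :\ b]setD1_notin // /A (disjointFl AB).
rewrite -big_setU_disjoint //=; apply: congr_big => // [s|s _].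
  rewrite subsetD1 LS cL /= andbT.
  have -> : (s \in S) = (s \in L :|: partA U S L :|: partB U S L) by rewrite -SE.
  rewrite -/A -/B !in_setU.
  case: (boolP (s \in L)) => /= sL; last by rewrite andbT.
  by rewrite (disjointFr LA) ?(disjointFr LB).
by rewrite partA_setD1 partB_setD1.
Qed.

Section Links.
Variables (U : {set {set 'I_n.+1}}) (i : nat) (S L : {set 'I_n.+1}).
Hypotheses (hU : consistent i.+1 U) (Li : #|L| = i).

(* The partition of [S :\: L] once the elements of [D] have been passed; an
   element moves from [B] to [A] or from [A] to [B] according to the parity of
   [cabove L]. *)
Definition stateA (D : {set 'I_n.+1}) :=
  [set a in S :\: L | (a \in D) (+) odd (cabove L a)].
Definition stateB (D : {set 'I_n.+1}) :=
  [set a in S :\: L | ~~ ((a \in D) (+) odd (cabove L a))].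
Definition predecessors l := [set x in S :\: L | link_rel U L x l].

(** Adding [l] to [L] raises [cabove L a] by one exactly when [a < l]; this bit and membership in
    [U] combine to [link_rel U L a l]. *)
Lemma partA_predecessors l : l \in S :\: L ->
  partA U S (l |: L) = stateA (predecessors l) :\ l.
Proof.
rewrite !inE => /andP[lL lS]; apply/setP => a; rewrite !inE /link_rel.
have [->|al] := eqVneq a l; first by [].
case: (boolP (a \in L)) => aL //=; case: (a \in S) => //=.
rewrite caboveU1 // oddD.
by case: (_ |: _ \in U); case: (a < l)%N; case: (odd (cabove L a)).
Qed.

Lemma partB_predecessors l : l \in S :\: L ->
  partB U S (l |: L) = stateB (predecessors l) :\ l.
Proof.
move=> lP; rewrite /partB partA_predecessors //; apply/setP => a; rewrite !inE.
case: (eqVneq a l) => //= al; case: (a \in L); case: (a \in S); by rewrite ?andbF ?andbT.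
Qed.

(** For even [cabove L l], passing [l] moves it from [B] to [A]. For odd it moves back from [A] to
    [B], and the sign reverses the difference, so each term is the state before minus the state
    after. *)
Lemma sum_links :
  \sum_(l in S :\: L) (-1) ^+ cabove L l *:
      (summand S L (partA U S (l |: L)) (l |: partB U S (l |: L))
       - summand S L (l |: partA U S (l |: L)) (partB U S (l |: L))) =
  summand S L (stateA set0) (stateB set0)
  - summand S L (stateA (S :\: L)) (stateB (S :\: L)).
Proof.
pose F D := summand S L (stateA D) (stateB D).
have PL x : x \in S :\: L -> x \notin L by rewrite inE => /andP[].
rewrite -[RHS](@sum_telescope_total _ _ (link_rel U L) F); first last.
- by move=> y x z /PL yL /PL xL /PL zL; exact: (link_rel_trans hU Li xL yL zL).
- by move=> x y _ _; apply: link_rel_total.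
- by move=> x _; apply: link_rel_irr.
apply: eq_bigr => l lP; rewrite partA_predecessors // partB_predecessors //.
rewrite -/(predecessors l) /F; set D := predecessors l.
have lD : l \notin D by rewrite !inE link_rel_irr andbF.
have [lL lS] : l \notin L /\ l \in S by move: lP; rewrite inE => /andP.
have E1 : stateA (l |: D) :\ l = stateA D :\ l.
  by apply/setP => x; rewrite !inE; case: (eqVneq x l).
have E2 : stateB (l |: D) :\ l = stateB D :\ l.
  by apply/setP => x; rewrite !inE; case: (eqVneq x l).
have inA E : (l \in stateA E) = (l \in E) (+) odd (cabove L l) by rewrite inE lP.
have inB E : (l \in stateB E) = ~~ ((l \in E) (+) odd (cabove L l)) by rewrite inE lP.
have := (inA D, inA (l |: D), inB D, inB (l |: D)).
rewrite (negPf lD) setU11 -signr_odd.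
case: (odd (cabove L l)) => -[[[/= lAD lAlD] lBD] lBlD];
  rewrite ?scaleN1r ?scale1r ?opprB; congr (_ - _); congr summand.
- by rewrite setD1K.
- by rewrite setD1_notin ?lBD.
- by rewrite -E1 setD1_notin ?lAlD.
- by rewrite -E2 setD1K.
- by rewrite setD1_notin ?lAD.
- by rewrite setD1K.
- by rewrite -E1 setD1K.
- by rewrite -E2 setD1_notin ?lBlD.
Qed.

End Links.

(** For empty [U] the part [A] is given by odd [cabove L], as in the initial state; passing every
    element flips all memberships. *)
Lemma state_parts0 S L :
  [/\ stateA S L set0 = partA set0 S L, stateB S L set0 = partB set0 S L,
      stateA S L (S :\: L) = partB set0 S L & stateB S L (S :\: L) = partA set0 S L].
Proof.
by split; apply/setP => x; rewrite !inE; case: (x \in L); case: (x \in S);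
  case: (odd (cabove L x)).
Qed.

Lemma partA0_set0 S : partA set0 S set0 = set0.
Proof.
apply/setP => x; rewrite !inE /= /cabove (_ : [set _ in _ | _] = set0) ?cards0 ?andbF //.
by apply/setP => y; rewrite !inE.
Qed.

Lemma summand0l S B : summand S set0 set0 B = 0.
Proof. by rewrite /summand set0U gen0 tens0l scaler0. Qed.

Lemma summand0r S A : summand S set0 A set0 = 0.
Proof. by rewrite /summand set0U [in X in tens _ X]set0U gen0 tens0r scaler0. Qed.

Lemma swap_summand i S L A B : part3 S L A B -> #|L| = i.+1 ->
  summand S L B A = (-1) ^+ i *: swap (summand S L A B).
Proof.
move=> p3 Li; rewrite /summand linearZ /= swap_tens !scalerA -!exprD.
by apply: eq_signr; rewrite (epsilon_swap p3 Li) addnAC.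
Qed.

(** For [i = 0] only the empty [L] occurs; then [A] is empty and both terms contain [gen set0 = 0],
    in accordance with the convention. Otherwise the swap gives the exchanged partition. *)
Lemma coproduct_pred_gen i S :
  coproduct_pred i (gen S) + (-1) ^+ i *: swap (coproduct_pred i (gen S)) =
  \sum_(L : {set 'I_n.+1} | (L \subset S) && (#|L| == i))
    (summand S L (partA set0 S L) (partB set0 S L)
     - summand S L (partB set0 S L) (partA set0 S L)).
Proof.
case: i => [|i] /=.
  rewrite linear0 scaler0 addr0 big1 // => L /andP[_ /eqP/cards0_eq->].
  by rewrite partA0_set0 summand0l summand0r subrr.
rewrite coproduct_genE linear_sum scaler_sumr -big_split.
apply: eq_bigr => L /andP[LS /eqP cL].
by rewrite (swap_summand (part3_parts set0 LS) cL) exprS mulN1r scaleNr.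
Qed.

End Assembly.

Theorem theorem3p7 (n i : nat) (U : {set {set 'I_n.+1}})
  (hU : consistent i.+1 U) (x : chain n) :
  bdry2 (coproduct i U x) - (-1) ^+ i *: coproduct i U (bdry x)
  = coproduct_pred i x + (-1) ^+ i *: swap (coproduct_pred i x).
Proof.
elim/chain_ind: x => [|x y Hx Hy|c x Hx|X].
- by case: i {hU} => [|i] /=; rewrite !linear0 ?scaler0 ?subr0 ?addr0.
- transitivity ((bdry2 (coproduct i U x) - (-1) ^+ i *: coproduct i U (bdry x))
    + (bdry2 (coproduct i U y) - (-1) ^+ i *: coproduct i U (bdry y))).
    by rewrite !linearD /= addrACA.
  rewrite Hx Hy; case: i {hU Hx Hy} => [|i] /=; first by rewrite !linear0 !addr0.
  by rewrite !linearD /= addrACA.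
- transitivity (c *: (bdry2 (coproduct i U x) - (-1) ^+ i *: coproduct i U (bdry x))).
    by rewrite !linearZ /= scalerDr !scalerA [in LHS]mulrC.
  rewrite Hx; case: i {hU Hx} => [|i] /=; first by rewrite !linear0 addr0 scaler0.
  by rewrite !linearZ /= scalerDr !scalerA.
rewrite coproduct_pred_gen coproduct_genE linear_sum coproduct_bdry scaler_sumr -sumrB.
set S := val X.
(* The first argument stands for the smaller set [L :\ l], by which [sum_flags] groups the terms. *)
pose H L l := (-1) ^+ cabove L l *:
  (summand S L (partA U S (l |: L)) (l |: partB U S (l |: L))
   - summand S L (l |: partA U S (l |: L)) (partB U S (l |: L))).
transitivity (\sum_(L : {set 'I_n.+1} | (L \subset S) && (#|L| == i.+1))
    \sum_(l in L) H (L :\ l) l).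
  apply: eq_bigr => L /andP[LS /eqP cL].
  rewrite /= -/(summand _ _ _ _) (bdry2_summand (part3_parts U LS) cL) addrC addKr.
  by apply: eq_bigr => l lL; rewrite /H setD1K.
rewrite sum_flags; apply: eq_bigr => L /andP[LS /eqP cL].
rewrite (sum_links S hU cL).
by have [-> -> -> ->] := state_parts0 S L.
Qed.
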